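(* Let $N\ge1$ and $M\ge 2$ be integers. (i) If a set of $R$ configurations of an $M$-mode linear optical interferometer followed by photon counting allows reconstruction of every $N$-photon, $M$-mode state, then $$R\ge R_{N,M}:=\binom{N+M}{N}-\binom{N+M-2}{M}.$$ (ii) More generally, for an interferometer with $M'>M\ge 2$ modes, where the $N$-photon $M$-mode state is supplemented by $M'-M$ ancillary modes in the vacuum state, any set of $R$ configurations allowing reconstruction of every $N$-photon, $M$-mode state satisfies $$R\ge R_{N,M,M'}:=\left\lceil \frac{(N+M-2)!\,(M'-2)!}{(N+M'-2)!\,(M-2)!}\,R_{N,M}\right\rceil.$$
   Context: Let $a_1,\dots,a_{M'}$ be bosonic annihilation operators of $M'\ge M$ optical modes. An $N$-photon, $M$-mode state is a density operator $\rho$ on the span of Fock states $|k_1,\dots,k_M\rangle$ with $\sum_j k_j=N$. When $M'>M$ the input to the interferometer is $\rho\otimes|0\rangle\langle0|$ with the last $M'-M$ modes in vacuum. A configuration of an $M'$-mode linear optical interferometer is a unitary $g=e^{iH}\in\mathrm U(M')$ acting on Fock space as $U(g)=\exp\!\big(i\sum_{k,l}H_{kl}a_k^\dagger a_l\big)$. Photon counting on all $M'$ output modes after configuration $g$ gives outcome $\nu'$ (an $M'$-mode Fock state with $N$ photons) with probability $p_{\nu',g}=\langle\nu'|U(g)^\dagger(\rho\otimes|0\rangle\langle 0|)U(g)|\nu'\rangle$. A set of configurations $g_1,\dots,g_R$ allows reconstruction if the probabilities $(p_{\nu',g_j})_{\nu',j}$ determine $\rho$ uniquely (the map $\rho\mapsto(p_{\nu',g_j})$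 is injective). $\lceil x\rceil$ denotes the smallest integer greater than or equal to $x$. *)

(* Defs.v *)
(* mathcomp + mathcomp-reals (realType) + real-closed (complex R = R[i]). *)
From HB Require Import structures.
From mathcomp Require Import all_boot all_order all_algebra all_fingroup.
From mathcomp Require Import reals.
From mathcomp Require Import complex.

Set Implicit Arguments. Unset Strict Implicit. Unset Printing Implicit Defensive.
Import Order.TTheory GRing.Theory Num.Theory.
Local Open Scope ring_scope.

(* N-photon, M-mode Fock basis states |k_1,...,k_M>, sum k_i = N. *)
Definition fock (M N : nat) :=
  {k : {ffun 'I_M -> 'I_N.+1} | (\sum_(i < M) (k i : nat) == N)%N}.

Definition occ (M N : nat) (k : fock M N) (i : 'I_M) : nat := val k i.

(* k! := prod_i k_i! *)
Definition fock_fact (M N : nat) (k : fock M N) : nat := (\prod_(i < M) (occ k i)`!)%N.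

(* the photons of Fock state mu: pairs (mode j, copy c < mu_j) *)
Definition photons (M N : nat) (mu : fock M N) := {j : 'I_M & 'I_(occ mu j)}.

Section Optics.
Variable R : realType.
Local Notation C := R[i].

(* <nu| U(g) |mu> for g in U(M), where U(g) a_j^dag U(g)^dag = sum_k g_kj a_k^dag :
   U(g)|mu> = prod_j (sum_k g_kj a_k^dag)^{mu_j}/sqrt(mu_j!) |0>, so the amplitude is
   sqrt(nu!)/sqrt(mu!) * [x^nu] prod_j (sum_k g_kj x_k)^{mu_j}. *)
Definition Uamp (M N : nat) (g : 'M[C]_M) (nu mu : fock M N) : C :=
  sqrtC (fock_fact nu)%:R / sqrtC (fock_fact mu)%:R *
  \sum_(f : {ffun photons mu -> 'I_M} |
          [forall k : 'I_M, #|[pred p | f p == k]| == occ nu k])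
     \prod_(p : photons mu) g (f p) (tag p).

Definition unitary (M : nat) (g : 'M[C]_M) : Prop :=
  g *m (map_mx (fun z : C => z^*) g)^T = 1%:M.

(* density operators on the N-photon, M-mode space *)
Definition density (M N : nat) (rho : fock M N -> fock M N -> C) : Prop :=
  (forall a b, rho b a = (rho a b)^*) /\
  (forall v : fock M N -> C, 0 <= \sum_a \sum_b (v a)^* * rho a b * v b) /\
  \sum_a rho a a = 1.

(* mu (M' modes) is a extended by vacuum in the last M'-M modes *)
Definition is_ext (M M' N : nat) (a : fock M N) (mu : fock M' N) : bool :=
  [forall i : 'I_M', occ mu i == oapp (fun j : 'I_M => occ a j) 0%N (insub (val i))].

(* rho (x) |0><0| *)
Definition vac_ext (M M' N : nat) (rho : fock M N -> fock M N -> C)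
  (mu nu : fock M' N) : C :=
  \sum_(a : fock M N) \sum_(b : fock M N)
     (if is_ext a mu && is_ext b nu then rho a b else 0).

(* p_{nu',g} = <nu'| U(g)^dag (rho (x) |0><0|) U(g) |nu'> *)
Definition prob (M M' N : nat) (rho : fock M N -> fock M N -> C)
  (g : 'M[C]_M') (nu : fock M' N) : C :=
  \sum_(a : fock M' N) \sum_(b : fock M' N)
     (Uamp g a nu)^* * vac_ext rho a b * Uamp g b nu.

(* configurations g_1..g_R allow reconstruction of every N-photon M-mode state *)
Definition allows_reconstruction (M M' N Rn : nat) (g : 'I_Rn -> 'M[C]_M') : Prop :=
  forall rho1 rho2 : fock M N -> fock M N -> C,
    density rho1 -> density rho2 ->
    (forall (j : 'I_Rn) (nu : fock M' N), prob rho1 (g j) nu = prob rho2 (g j) nu) ->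
    rho1 = rho2.

End Optics.

Definition R_NM (N M : nat) : nat := ('C(N + M, N) - 'C(N + M - 2, M))%N.

Definition R_NMM' (N M M' : nat) : int :=
  Num.ceil ((((N + M - 2)`! * (M' - 2)`!)%N%:R / ((N + M' - 2)`! * (M - 2)`!)%N%:R
             * (R_NM N M)%:R) : rat).

(* Main.v *)
Require Import Defs.
From HB Require Import structures.
From mathcomp Require Import all_boot all_order all_algebra.
From mathcomp Require Import reals complex mpoly ring zify.

(* The photon loss X |-> sum_k a_k X a_k^dag maps N-photon operators to
   (N-1)-photon operators and commutes with every interferometer. Hence the
   outcome distribution p of an operator X that it annihilates satisfies
   sum_i (kappa_i + 1) p_{kappa + e_i} = 0 for every (N-1)-photon kappa, so that
   p is determined by the outcomes leaving one given mode empty, of which there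
   are C(N+M'-2, N). Reconstruction separates all traceless operators (a small
   multiple of a Hermitian one can be added to the maximally mixed state), and
   the operators annihilated by the loss are traceless. These form a space of
   dimension at least d_N^2 - d_(N-1)^2 = (d_N - d_(N-1)) (d_N + d_(N-1)) where
   d_N = C(N+M-1, N), that is C(N+M-2, N) R_(N,M), and R configurations provide
   only R C(N+M'-2, N) linear forms to separate them. *)

Set Implicit Arguments.
Unset Strict Implicit.
Unset Printing Implicit Defensive.
Import Order.TTheory GRing.Theory Num.Theory.
Local Open Scope ring_scope.

Lemma leq_sum_term (I : finType) (f : I -> nat) (i : I) : (f i <= \sum_j f j)%N.
Proof. by rewrite (bigD1 i) //= leq_addr. Qed.

Section Fibers.
Variables (V : nmodType) (I J : finType) (h : I -> J).
Implicit Type F : I -> V.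

Lemma big_fiber_inj F i : injective h -> \sum_(i' | h i' == h i) F i' = F i.
Proof. by move=> h_inj; rewrite (big_pred1 i) // => i'; rewrite (inj_eq h_inj). Qed.

Lemma big_fiber0 F j : j \notin codom h -> \sum_(i | h i == j) F i = 0.
Proof.
move=> j_codom; rewrite big_pred0 // => i.
by apply: contraNF j_codom => /eqP <-; exact: codom_f.
Qed.

End Fibers.

Lemma ex_linear_ker_neq0 (F : fieldType) (vT wT : vectType F) (f : vT -> wT) :
  linear f -> (dim wT < dim vT)%N -> exists2 v, v != 0 & f v = 0.
Proof.
move=> f_lin lt_dim.
pose fL : {linear vT -> wT} := HB.pack f (GRing.isLinear.Build _ _ _ _ f f_lin).
exists (vpick (lker (linfun fL))).
  rewrite vpick0 -dimv_eq0 -lt0n -(ltn_add2r (\dim (limg (linfun fL)))) add0n.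
  rewrite -[lker _]capfv limg_ker_dim dimvf; apply: leq_ltn_trans lt_dim.
  by rewrite -dimvf dimvS ?subvf.
by have := memv_pick (lker (linfun fL)); rewrite memv_ker lfunE => /eqP.
Qed.

Lemma dim_ffun_regular (F : fieldType) (I : finType) : dim {ffun I -> F^o} = #|I|.
Proof. exact: muln1. Qed.

Lemma dim_prod (F : fieldType) (uT vT : vectType F) :
  dim (uT * vT)%type = (dim uT + dim vT)%N.
Proof. by []. Qed.

Section HermitianForms.
Variable C : numClosedFieldType.

Definition qform (I : finType) (X : I -> I -> C) (u : I -> C) : C :=
  \sum_a \sum_b (u a)^* * X a b * u b.

Definition sqnorm (I : finType) (u : I -> C) : C := \sum_a `|u a| ^+ 2.

Definition trace (I : finType) (X : I -> I -> C) : C := \sum_a X a a.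

Definition entry_norm (I : finType) (X : I -> I -> C) : C := \sum_a \sum_b `|X a b|.

Definition selfadjoint (I : Type) (X : I -> I -> C) : Prop :=
  forall a b, X b a = (X a b)^*.

Definition scalar_op (I : eqType) (c : C) (a b : I) : C := (a == b)%:R * c.

Definition herm_part (I : Type) (X : I -> I -> C) (a b : I) : C := X a b + (X b a)^*.

Lemma herm_part_selfadjoint (I : Type) (X : I -> I -> C) : selfadjoint (herm_part X).
Proof. by move=> a b; rewrite /herm_part rmorphD /= conjCK addrC. Qed.

Lemma herm_part_eq0 (I : Type) (X : I -> I -> C) (a b : I) :
  herm_part X a b = 0 -> herm_part (fun a b => 'i * X a b) a b = 0 -> X a b = 0.
Proof.
rewrite /herm_part rmorphM /= conjCi mulNr -mulrBr => sum0 /eqP.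
rewrite mulf_eq0 (negPf (neq0Ci _)) /= subr_eq0 => /eqP X_real.
by move/eqP: sum0; rewrite -X_real -mulr2n mulrn_eq0 /= => /eqP.
Qed.

Section FixedIndex.
Variable I : finType.
Implicit Types (X Y : I -> I -> C) (u v w : I -> C).

Lemma eq_qform X Y u v : X =2 Y -> u =1 v -> qform X u = qform Y v.
Proof.
by move=> XY uv; apply: eq_bigr => a _; apply: eq_bigr => b _; rewrite XY !uv.
Qed.

Lemma qformD X Y u : qform (fun a b => X a b + Y a b) u = qform X u + qform Y u.
Proof.
rewrite -big_split; apply: eq_bigr => a _ /=; rewrite -big_split; apply: eq_bigr => b _ /=.
by rewrite mulrDr mulrDl.
Qed.

Lemma qformZ c X u : qform (fun a b => c * X a b) u = c * qform X u.
Proof.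
rewrite mulr_sumr; apply: eq_bigr => a _; rewrite mulr_sumr; apply: eq_bigr => b _.
by rewrite mulrCA !mulrA.
Qed.

Lemma qform_sum (K : finType) (X : K -> I -> I -> C) u :
  qform (fun a b => \sum_k X k a b) u = \sum_k qform (X k) u.
Proof.
rewrite /qform [RHS]exchange_big; apply: eq_bigr => a _ /=.
rewrite [RHS]exchange_big; apply: eq_bigr => b _.
by rewrite mulr_sumr mulr_suml.
Qed.

Lemma qform_weight X w u :
  qform X (fun a => w a * u a) = qform (fun a b => (w a)^* * w b * X a b) u.
Proof.
by apply: eq_bigr => a _; apply: eq_bigr => b _; rewrite rmorphM /=; ring.
Qed.

Lemma qform_adjoint X u : qform (fun a b => (X b a)^*) u = (qform X u)^*.
Proof.
rewrite /qform exchange_big rmorph_sum; apply: eq_bigr => a _ /=; rewrite rmorph_sum.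
by apply: eq_bigr => b _; rewrite !rmorphM /= conjCK; ring.
Qed.

Lemma qform_herm_part X u : qform (herm_part X) u = qform X u + (qform X u)^*.
Proof. by rewrite qformD qform_adjoint. Qed.

Lemma qform_real X u : selfadjoint X -> qform X u \is Num.real.
Proof. by move=> X_adj; apply/CrealP; rewrite -qform_adjoint; apply: eq_qform. Qed.

Lemma qform_scalar_op c u : qform (scalar_op c) u = c * sqnorm u.
Proof.
rewrite mulr_sumr; apply: eq_bigr => a _; rewrite (bigD1 a) //= big1 => [|b ba].
  by rewrite /scalar_op eqxx mul1r addr0 normCKC mulrAC mulrC.
by rewrite /scalar_op eq_sym (negPf ba) !(mul0r, mulr0).
Qed.

Lemma sqnorm_ge0 u : 0 <= sqnorm u.
Proof. by rewrite sumr_ge0 // => a _; rewrite exprn_ge0. Qed.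

Lemma norm_mul_le_sqnorm u a b : `|u a| * `|u b| <= sqnorm u.
Proof.
have sq_le c : `|u c| ^+ 2 <= sqnorm u.
  by rewrite /sqnorm (bigD1 c) //= lerDl sumr_ge0 // => d _; rewrite exprn_ge0.
rewrite -(@ler_pXn2r _ 2) ?nnegrE ?mulr_ge0 ?sqnorm_ge0 // exprMn [sqnorm u ^+ 2]expr2.
by rewrite ler_pM ?exprn_ge0.
Qed.

Lemma norm_qform_le X u : `|qform X u| <= entry_norm X * sqnorm u.
Proof.
rewrite mulr_suml; apply: le_trans (ler_norm_sum _ _ _) _; apply: ler_sum => a _.
rewrite mulr_suml; apply: le_trans (ler_norm_sum _ _ _) _; apply: ler_sum => b _.
by rewrite !normrM norm_conjC mulrAC mulrC ler_wpM2l ?norm_mul_le_sqnorm.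
Qed.

Lemma qform_perturb_ge0 X c u :
  selfadjoint X -> entry_norm X <= c -> 0 <= qform (fun a b => X a b + scalar_op c a b) u.
Proof.
move=> X_adj leXc; rewrite qformD qform_scalar_op.
have le_scalar : entry_norm X * sqnorm u <= c * sqnorm u by rewrite ler_wpM2r ?sqnorm_ge0.
have qform_ge := real_lerNnormlW (qform_real u X_adj) (norm_qform_le X u).
by apply: le_trans (lerD qform_ge le_scalar); rewrite addNr.
Qed.

Lemma entry_normZ c X : entry_norm (fun a b => c * X a b) = `|c| * entry_norm X.
Proof.
rewrite mulr_sumr; apply: eq_bigr => a _; rewrite mulr_sumr.
by apply: eq_bigr => b _; rewrite normrM.
Qed.

Lemma trace_scalar_op c : trace (scalar_op c : I -> I -> C) = #|I|%:R * c.
Proof.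
rewrite /trace; under eq_bigr do rewrite /scalar_op eqxx mul1r.
by rewrite sumr_const mulr_natl.
Qed.

End FixedIndex.

Lemma qform_correspondence (I J : finType) (r : I -> J -> bool) (X : I -> I -> C)
    (u : J -> C) :
  qform (fun i j => \sum_(a | r a i) \sum_(b | r b j) X a b) u =
  qform X (fun a => \sum_(i | r a i) u i).
Proof.
transitivity (\sum_i \sum_(a | r a i) (u i)^* * \sum_j \sum_(b | r b j) X a b * u j).
  apply: eq_bigr => i _; under eq_bigr do rewrite -mulrA mulr_suml.
  rewrite -!mulr_sumr exchange_big; congr (_ * _); apply: eq_bigr => a _ /=.
  by apply: eq_bigr => j _; rewrite mulr_suml.
rewrite (exchange_big_dep xpredT) //=; apply: eq_bigr => a _.
rewrite -mulr_suml -rmorph_sum; under [RHS]eq_bigr do rewrite -mulrA.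
rewrite -mulr_sumr (exchange_big_dep xpredT) //=; congr (_ * _).
by apply: eq_bigr => b _; rewrite mulr_sumr.
Qed.

Lemma qform_pushforward (I J : finType) (h : I -> J) (X : J -> J -> C) (u : I -> C) :
  qform X (fun j => \sum_(a | h a == j) u a) = qform (fun a b => X (h a) (h b)) u.
Proof.
rewrite -(qform_correspondence (fun j a => h a == j)); apply: eq_qform => // a b.
rewrite (big_pred1 (h a)) => [|j]; last exact: eq_sym.
by rewrite (big_pred1 (h b)) // => j; exact: eq_sym.
Qed.

Section Isometry.
Variables (K T : finType) (G : K -> T -> C).
Hypothesis G_orthonormal : forall k l, \sum_t G l t * (G k t)^* = (l == k)%:R.

Lemma dot_isometry (x y : K -> C) :
  \sum_t (\sum_k G k t * x k)^* * (\sum_k G k t * y k) = \sum_k (x k)^* * y k.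
Proof.
transitivity (\sum_k \sum_l (x k)^* * y l * \sum_t G l t * (G k t)^*).
  under eq_bigr do rewrite rmorph_sum mulr_suml /=.
  rewrite exchange_big; apply: eq_bigr => k _ /=.
  under eq_bigr do rewrite mulr_sumr.
  rewrite exchange_big; apply: eq_bigr => l _ /=.
  by rewrite mulr_sumr; apply: eq_bigr => t _; rewrite rmorphM /=; ring.
apply: eq_bigr => k _; rewrite (bigD1 k) //= G_orthonormal eqxx mulr1 big1 ?addr0 // => l.
by rewrite G_orthonormal => /negPf ->; rewrite mulr0.
Qed.

Lemma qform_isometry (I : finType) (X : I -> I -> C) (u : K -> I -> C) :
  \sum_t qform X (fun a => \sum_k G k t * u k a) = \sum_k qform X (u k).
Proof.
rewrite /qform exchange_big [RHS]exchange_big; apply: eq_bigr => a _ /=.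
rewrite exchange_big [RHS]exchange_big; apply: eq_bigr => b _ /=.
under [RHS]eq_bigr do rewrite mulrAC.
by rewrite -[RHS]mulr_suml -dot_isometry mulr_suml; apply: eq_bigr => t _; rewrite mulrAC.
Qed.

End Isometry.

End HermitianForms.

Lemma sqrtC_natM (C : numClosedFieldType) (m n : nat) :
  sqrtC (m * n)%:R = sqrtC m%:R * sqrtC n%:R :> C.
Proof. by rewrite natrM sqrtCM ?qualifE /= ?ler0n. Qed.

Lemma conj_sqrtC_nat (C : numClosedFieldType) (n : nat) :
  (sqrtC n%:R)^* = sqrtC n%:R :> C.
Proof. by rewrite conj_Creal // ger0_real // sqrtC_ge0 ler0n. Qed.

Section FockStates.
Variables M N : nat.
Implicit Types (a b : fock M N) (f : 'I_M -> nat).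

Lemma eq_fock a b : occ a =1 occ b -> a = b.
Proof. by move=> ab; apply/val_inj/ffunP => i; apply/val_inj/ab. Qed.

Lemma sum_occ a : (\sum_i occ a i = N)%N.
Proof. exact/eqP/(valP a). Qed.

Fact fock_of_subproof f :
  (\sum_i f i = N)%N -> (\sum_i ([ffun i => inord (f i)] : {ffun 'I_M -> 'I_N.+1}) i == N)%N.
Proof.
move=> fN; apply/eqP; rewrite -[RHS]fN; apply: eq_bigr => i _.
by rewrite ffunE inordK // -fN ltnS leq_sum_term.
Qed.

Definition fock_of f (fN : (\sum_i f i = N)%N) : fock M N :=
  exist _ [ffun i => inord (f i)] (fock_of_subproof fN).

Lemma occ_fock_of f (fN : (\sum_i f i = N)%N) : occ (fock_of fN) =1 f.
Proof. by move=> i; rewrite /occ /= ffunE inordK // -fN ltnS leq_sum_term. Qed.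

End FockStates.

Lemma card_fock (m n : nat) : #|{: fock m.+1 n}| = 'C(m + n, m).
Proof.
pose tuple_of (f : {ffun 'I_m.+1 -> 'I_n.+1}) := [tuple f i | i < m.+1].
have tuple_of_bij : bijective tuple_of.
  exists (fun t => [ffun i => tnth t i]) => [f | t].
    by apply/ffunP => i; rewrite ffunE tnth_mktuple.
  by apply: eq_from_tnth => i; rewrite tnth_mktuple ffunE.
rewrite card_sig -card_ord_partitions -(on_card_preimset (onW_bij _ tuple_of_bij)).
rewrite cardsE; apply: eq_card => f; rewrite [RHS]inE inE big_tuple.
by under [in RHS]eq_bigr do rewrite tnth_mktuple.
Qed.

Section Creation.
Variables M N : nat.
Implicit Types (a : fock M N) (b : fock M N.+1) (k : 'I_M).

Fact create_subproof k a : (\sum_i (occ a i + (i == k)) = N.+1)%N.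
Proof.
by rewrite big_split /= sum_occ -addn1 (bigD1 k) //= eqxx big1 // => i /negPf ->.
Qed.

Definition create k a : fock M N.+1 := fock_of (create_subproof k a).

Lemma occ_create k a i : occ (create k a) i = (occ a i + (i == k))%N.
Proof. exact: occ_fock_of. Qed.

Lemma occ_create_id k a : occ (create k a) k = (occ a k).+1.
Proof. by rewrite occ_create eqxx addn1. Qed.

Lemma occ_create_neq k a i : i != k -> occ (create k a) i = occ a i.
Proof. by rewrite occ_create => /negPf ->; rewrite addn0. Qed.

Lemma create_inj k : injective (create k).
Proof.
move=> a a' eq_create; apply: eq_fock => i.
by have := congr1 (fun c => occ c i) eq_create; rewrite !occ_create => /addIn.
Qed.

Lemma mem_codom_create k b : (b \in codom (create k)) = (0 < occ b k)%N.
Proof.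
apply/codomP/idP => [[a ->] | b_gt0]; first by rewrite occ_create_id.
have k_le i : ((i == k) <= occ b i)%N by case: eqP => // ->.
have sumN : (\sum_i (occ b i - (i == k)) = N)%N.
  rewrite sumnB // sum_occ (bigD1 k) //= eqxx big1 ?addn0 ?subn1 //.
  by move=> i /negPf ->.
by exists (fock_of sumN); apply: eq_fock => i; rewrite occ_create occ_fock_of subnK.
Qed.

Lemma big_create (V : nmodType) k (F : fock M N.+1 -> V) :
  \sum_(b | (0 < occ b k)%N) F b = \sum_a F (create k a).
Proof.
rewrite -[RHS](big_image _ _ (create k)) [RHS]big_uniq /=.
  by apply: eq_bigl => b; rewrite -mem_codom_create.
by rewrite map_inj_uniq ?enum_uniq //; exact: create_inj.
Qed.

Lemma fock_fact_create k a : fock_fact (create k a) = ((occ a k).+1 * fock_fact a)%N.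
Proof.
rewrite /fock_fact (bigD1 k) //= [in RHS](bigD1 k) //= occ_create_id factS mulnA.
by congr (_ * _)%N; apply: eq_bigr => i ik; rewrite occ_create_neq.
Qed.

Lemma card_empty_mode k :
  (#|[pred b : fock M N.+1 | occ b k == 0%N]| + #|{: fock M N}| = #|{: fock M N.+1}|)%N.
Proof.
rewrite -[RHS](cardC [pred b | occ b k == 0%N]); congr addn.
rewrite -[#|{: fock M N}|](card_codom (@create_inj k)).
by apply: eq_card => b; rewrite mem_codom_create !inE lt0n.
Qed.

(* The relation at [a] expresses [q] at [create k a] through states with fewer
   photons in mode [k]. *)
Lemma eq0_of_create_sum (F : idomainType) k (w : fock M N -> 'I_M -> F)
    (q : fock M N.+1 -> F) :
  (forall a, w a k != 0) -> (forall a, \sum_i w a i * q (create i a) = 0) ->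
  (forall b, occ b k = 0%N -> q b = 0) -> forall b, q b = 0.
Proof.
move=> w_neq0 sum0 q0 b; have [t] := ubnP (occ b k); elim: t b => // t IHt b.
rewrite ltnS => occ_le; have [/q0 // | b_gt0] := posnP (occ b k).
move: b_gt0 occ_le; rewrite -mem_codom_create => /codomP[a ->].
rewrite occ_create_id => occ_lt.
have := sum0 a; rewrite (bigD1 k) //= big1 ?addr0.
  by move/eqP; rewrite mulf_eq0 (negPf (w_neq0 a)) => /eqP.
by move=> i ik; rewrite IHt ?mulr0 // occ_create_neq // eq_sym.
Qed.

End Creation.

Lemma card_fock_empty_mode (m n : nat) (k : 'I_m.+2) :
  #|[pred b : fock m.+2 n.+1 | occ b k == 0%N]| = 'C(m + n.+1, m).
Proof.
have := card_empty_mode n k; rewrite !card_fock (addSnnS m n) addSn binS [RHS]addnC.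
exact: addIn.
Qed.

(* A creation operator a_k^dag is read as the variable 'X_k. *)
Section FockPolynomials.
Variable A : comNzRingType.

Definition mode_poly (M : nat) (g : 'M[A]_M) (j : 'I_M) : {mpoly A[M]} :=
  \sum_k (g k j)%:MP * 'X_k.

Definition fock_poly (M N : nat) (g : 'M[A]_M) (nu : fock M N) : {mpoly A[M]} :=
  \prod_j mode_poly g j ^+ occ nu j.

Definition fock_mnm (M N : nat) (a : fock M N) : 'X_{1..M} :=
  [multinom occ a i | i < M].

Lemma mcoeff_fock_poly (M N : nat) (g : 'M[A]_M) (a nu : fock M N) :
  (fock_poly g nu)@_(fock_mnm a) =
  \sum_(f : {ffun photons nu -> 'I_M} |
          [forall k : 'I_M, #|[pred p | f p == k]| == occ a k])
     \prod_(p : photons nu) g (f p) (tag p).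
Proof.
have -> : fock_poly g nu = \prod_(p : photons nu) mode_poly g (tag p).
  rewrite -(@sig_big_dep _ _ _ _ (fun j => 'I_(occ nu j)) xpredT (fun _ => xpredT)
             (fun j _ => mode_poly g j)) /=.
  by apply: eq_bigr => j _; rewrite prodr_const card_ord.
rewrite bigA_distr_bigA raddf_sum /= [RHS]big_mkcond; apply: eq_bigr => f _ /=.
rewrite big_split /= -rmorph_prod mcoeffCM.
under [X in _ * X@__]eq_bigr do rewrite -['X_(_)]expr1.
rewrite mprodXnE mcoeffX.
have mnm_countE k : (\sum_p U_(f p) *+ 1)%MM k = #|[pred p | f p == k]|.
  rewrite mnm_sumE -sum1_card [RHS]big_mkcond; apply: eq_bigr => p _ /=.
  by rewrite mulmnE mnm1E muln1 inE; case: eqP.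
rewrite (_ : [forall k, _] = ((\sum_p U_(f p) *+ 1)%MM == fock_mnm a)).
  by case: eqP; rewrite ?mulr1 ?mulr0.
apply/forallP/eqP => [count_f | mnm_f k]; last by rewrite -mnm_countE mnm_f mnmE.
by apply/mnmP => k; rewrite mnm_countE mnmE; apply/eqP.
Qed.

Lemma fock_poly_create (M N : nat) (g : 'M[A]_M) (i : 'I_M) (nu : fock M N) :
  fock_poly g (create i nu) = fock_poly g nu * mode_poly g i.
Proof.
rewrite /fock_poly (bigD1 i) //= [in RHS](bigD1 i) //= occ_create_id exprSr.
by rewrite mulrAC; do 2!congr (_ * _); apply: eq_bigr => j ji; rewrite occ_create_neq.
Qed.

Lemma fock_mnm_create (M N : nat) (k : 'I_M) (a : fock M N) :
  fock_mnm (create k a) = (U_(k) + fock_mnm a)%MM.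
Proof. by apply/mnmP => i; rewrite mnmDE mnm1E !mnmE occ_create addnC eq_sym. Qed.

Lemma mcoeffMX_fock (M N : nat) (p : {mpoly A[M]}) (k : 'I_M) (b : fock M N.+1) :
  (p * 'X_k)@_(fock_mnm b) = \sum_(a | create k a == b) p@_(fock_mnm a).
Proof.
have [/codomP[a ->] | b_codom] := boolP (b \in codom (create k)).
  by rewrite big_fiber_inj ?fock_mnm_create ?mcoeffMX //; exact: create_inj.
rewrite big_fiber0 // mcoeffM big1 // => -[m1 m2] /= /eqP bE; rewrite mcoeffX.
case: eqP => [m2E | _]; last by rewrite mulr0.
case/negP: b_codom; rewrite mem_codom_create.
have := congr1 (fun m : 'X_{1..M} => m k) bE.
by rewrite mnmDE -m2E mnm1E eqxx mnmE addn1 => ->.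
Qed.

Lemma mcoeff_fock_poly_create (M N : nat) (g : 'M[A]_M) (b : fock M N.+1) (i : 'I_M)
    (nu : fock M N) :
  (fock_poly g (create i nu))@_(fock_mnm b) =
  \sum_k g k i * \sum_(a | create k a == b) (fock_poly g nu)@_(fock_mnm a).
Proof.
rewrite fock_poly_create mulr_sumr raddf_sum; apply: eq_bigr => k _ /=.
by rewrite mulrCA mcoeffCM mcoeffMX_fock.
Qed.

End FockPolynomials.

Section VacuumExtension.
Variables (M M' : nat) (leMM' : (M <= M')%N).
Local Notation widen := (widen_ord leMM').

Lemma is_extP (N : nat) (a : fock M N) (mu : fock M' N) :
  reflect ((forall i, occ mu (widen i) = occ a i) /\
           (forall j : 'I_M', (M <= j)%N -> occ mu j = 0%N))
          (is_ext a mu).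
Proof.
have insub_widen (i : 'I_M) : insub (val (widen i)) = Some i by rewrite valK.
apply: (iffP forallP) => [ext | [ext_low ext_high] j].
  split=> [i | j leMj]; first by have /eqP := ext (widen i); rewrite insub_widen.
  by have /eqP := ext j; rewrite insubF // ltnNge leMj.
case: (ltnP j M) => [ltjM | leMj]; last by rewrite ext_high // insubF // ltnNge leMj.
by rewrite insubT /= -ext_low; apply/eqP; congr occ; exact: val_inj.
Qed.

Lemma is_ext_create (N : nat) (k : 'I_M) (a : fock M N) (mu : fock M' N) :
  is_ext (create k a) (create (widen k) mu) = is_ext a mu.
Proof.
have widen_inj : injective widen by move=> i j /(congr1 val) /= /val_inj.
apply/is_extP/is_extP => -[ext_low ext_high]; split=> i.
- by have := ext_low i; rewrite !occ_create (inj_eq widen_inj); exact: addIn.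
- by move/ext_high; rewrite occ_create; lia.
- by rewrite !occ_create (inj_eq widen_inj) ext_low.
- move=> leMi; rewrite occ_create ext_high // (_ : i == _ = false) //.
  by apply: contra_leqF leMi => /eqP ->; exact: (ltn_ord k).
Qed.

Lemma is_ext_create_vacuum (N : nat) (b : fock M N.+1) (j : 'I_M') (mu : fock M' N) :
  (M <= j)%N -> is_ext b (create j mu) = false.
Proof. by move=> leMj; apply/is_extP => -[_ /(_ j leMj)]; rewrite occ_create_id. Qed.

Lemma big_is_ext_create (V : nmodType) (N : nat) (k : 'I_M) (b : fock M N.+1)
    (F : fock M' N -> V) :
  \sum_(mu | is_ext b (create (widen k) mu)) F mu =
  \sum_(a | create k a == b) \sum_(mu | is_ext a mu) F mu.
Proof.
have [/codomP[a ->] | b_codom] := boolP (b \in codom (create k)).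
  rewrite big_fiber_inj; last exact: create_inj.
  by apply: eq_bigl => mu; rewrite is_ext_create.
rewrite big_fiber0 // big_pred0 // => mu.
apply: contraNF b_codom => /is_extP[/(_ k) bE _].
by rewrite mem_codom_create -bE occ_create_id.
Qed.

End VacuumExtension.

Section PhotonLoss.
Variable R : realType.
Local Notation C := R[i].

Lemma UampE (M N : nat) (g : 'M[C]_M) (a nu : fock M N) :
  Uamp g a nu =
  sqrtC (fock_fact a)%:R / sqrtC (fock_fact nu)%:R * (fock_poly g nu)@_(fock_mnm a).
Proof. by rewrite mcoeff_fock_poly. Qed.

(* The matrix element between b and nu of U(g) a_i^dag = (sum_k g_ki a_k^dag) U(g). *)
Lemma Uamp_create (M N : nat) (g : 'M[C]_M) (b : fock M N.+1) (i : 'I_M) (nu : fock M N) :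
  sqrtC (occ nu i).+1%:R * Uamp g b (create i nu) =
  \sum_k g k i * \sum_(a | create k a == b) sqrtC (occ a k).+1%:R * Uamp g a nu.
Proof.
rewrite UampE mcoeff_fock_poly_create fock_fact_create sqrtC_natM.
have sqrt_neq0 : sqrtC (occ nu i).+1%:R != 0 :> C by rewrite sqrtC_eq0 pnatr_eq0.
rewrite invfM mulrA mulrCA mulVKf // mulr_sumr; apply: eq_bigr => k _.
rewrite mulrCA mulr_sumr; congr (_ * _); apply: eq_bigr => a /eqP <-.
by rewrite UampE fock_fact_create sqrtC_natM !mulrA.
Qed.

(* The amplitude <a, 0| U(g) |nu>. *)
Definition vac_amp (M M' N : nat) (g : 'M[C]_M') (a : fock M N) (nu : fock M' N) : C :=
  \sum_(mu | is_ext a mu) Uamp g mu nu.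

Lemma vac_amp_create (M M' N : nat) (leMM' : (M <= M')%N) (g : 'M[C]_M')
    (b : fock M N.+1) (i : 'I_M') (nu : fock M' N) :
  sqrtC (occ nu i).+1%:R * vac_amp g b (create i nu) =
  \sum_k g (widen_ord leMM' k) i *
     \sum_(a | create k a == b) sqrtC (occ a k).+1%:R * vac_amp g a nu.
Proof.
transitivity (\sum_j g j i *
    \sum_(mu | is_ext b (create j mu)) sqrtC (occ mu j).+1%:R * Uamp g mu nu).
  rewrite mulr_sumr; under eq_bigr do rewrite Uamp_create.
  rewrite exchange_big; apply: eq_bigr => j _ /=; rewrite -mulr_sumr; congr (_ * _).
  rewrite [RHS](partition_big (create j) (is_ext b)) //=; apply: eq_bigr => mu' b_mu'.
  by apply: eq_bigl => mu; case: eqP => [-> | _]; rewrite ?b_mu' ?andbF.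
rewrite (bigID (fun j : 'I_M' => (j < M)%N)) /= [X in _ + X]big1 ?addr0 => [|j]; last first.
  rewrite -leqNgt => leMj; rewrite big_pred0 ?mulr0 // => mu.
  exact: is_ext_create_vacuum.
rewrite (big_ord_narrow leMM'); apply: eq_bigr => k _; congr (_ * _).
rewrite big_is_ext_create; apply: eq_bigr => a _; rewrite mulr_sumr.
by apply: eq_bigr => mu /(is_extP leMM')[-> _].
Qed.

Lemma prob_qform (M M' N : nat) (X : fock M N -> fock M N -> C) (g : 'M[C]_M')
    (nu : fock M' N) :
  prob X g nu = qform X (vac_amp g ^~ nu).
Proof.
rewrite -(qform_correspondence (@is_ext M M' N)); apply: eq_qform => // mu mu'.
rewrite /vac_ext [RHS]big_mkcond; apply: eq_bigr => a _.
by case: (is_ext a mu); rewrite /= -?big_mkcond // big1.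
Qed.

Lemma prob_linear (M M' N : nat) (c : C) (X Y : fock M N -> fock M N -> C) (g : 'M[C]_M')
    (nu : fock M' N) :
  prob (fun a b => c * X a b + Y a b) g nu = c * prob X g nu + prob Y g nu.
Proof. by rewrite !prob_qform qformD qformZ. Qed.

(* X |-> sum_k a_k X a_k^dag *)
Definition loss (M N : nat) (X : fock M N.+1 -> fock M N.+1 -> C) (a b : fock M N) : C :=
  \sum_k sqrtC (occ a k).+1%:R * sqrtC (occ b k).+1%:R * X (create k a) (create k b).

Lemma loss_linear (M N : nat) (c : C) (X Y : fock M N.+1 -> fock M N.+1 -> C)
    (a b : fock M N) :
  loss (fun a' b' => c * X a' b' + Y a' b') a b = c * loss X a b + loss Y a b.
Proof.
by rewrite /loss mulr_sumr -big_split; apply: eq_bigr => k _ /=; rewrite mulrDr mulrCA.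
Qed.

Lemma trace_loss (M N : nat) (X : fock M N.+1 -> fock M N.+1 -> C) :
  trace (loss X) = N.+1%:R * trace X.
Proof.
transitivity (\sum_k \sum_(b : fock M N.+1) (occ b k)%:R * X b b).
  rewrite /trace exchange_big; apply: eq_bigr => k _ /=.
  rewrite [RHS](bigID (fun b => 0 < occ b k)%N) /= [X in _ + X]big1 ?addr0; last first.
    by move=> b; rewrite -eqn0Ngt => /eqP ->; rewrite mul0r.
  by rewrite big_create; apply: eq_bigr => a _; rewrite -expr2 sqrtCK occ_create_id.
rewrite exchange_big mulr_sumr; apply: eq_bigr => b _ /=.
by rewrite -mulr_suml -natr_sum sum_occ.
Qed.

Lemma unitary_orthonormal (M M' : nat) (leMM' : (M <= M')%N) (g : 'M[C]_M') :
  unitary g -> forall k l : 'I_M,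
  \sum_t g (widen_ord leMM' l) t * (g (widen_ord leMM' k) t)^* = (l == k)%:R.
Proof.
move=> g_unitary k l.
have /matrixP/(_ (widen_ord leMM' l) (widen_ord leMM' k)) := g_unitary.
by rewrite !mxE => <-; apply: eq_bigr => t _; rewrite !mxE.
Qed.

Lemma prob_loss (M M' N : nat) (leMM' : (M <= M')%N) (g : 'M[C]_M')
    (X : fock M N.+1 -> fock M N.+1 -> C) (nu : fock M' N) : unitary g ->
  \sum_i (occ nu i).+1%:R * prob X g (create i nu) = prob (loss X) g nu.
Proof.
move=> g_unitary.
pose lost (k : 'I_M) b := \sum_(a | create k a == b) sqrtC (occ a k).+1%:R * vac_amp g a nu.
transitivity (\sum_i qform X (fun b => \sum_k g (widen_ord leMM' k) i * lost k b)).
  apply: eq_bigr => i _; rewrite prob_qform -qformZ.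
  rewrite -[RHS](eq_qform (fun _ _ => erefl) (vac_amp_create leMM' g ^~ i ^~ nu)).
  rewrite qform_weight; apply: eq_qform => // a b.
  by rewrite conj_sqrtC_nat -expr2 sqrtCK.
rewrite (qform_isometry (unitary_orthonormal leMM' g_unitary)) prob_qform qform_sum.
apply: eq_bigr => k _; rewrite qform_pushforward qform_weight.
by apply: eq_qform => // a b; rewrite conj_sqrtC_nat.
Qed.

Lemma prob_eq0_of_loss_eq0 (M M' N : nat) (k : 'I_M') (g : 'M[C]_M')
    (X : fock M N.+1 -> fock M N.+1 -> C) :
  (M <= M')%N -> unitary g -> loss X =2 (fun _ _ => 0) ->
  (forall nu, occ nu k = 0%N -> prob X g nu = 0) -> forall nu, prob X g nu = 0.
Proof.
move=> leMM' g_unitary loss0; apply: (eq0_of_create_sum (w := fun nu i => (occ nu i).+1%:R)).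
  by move=> nu; rewrite pnatr_eq0.
move=> nu; rewrite prob_loss // prob_qform (eq_qform loss0 (fun _ => erefl)).
by rewrite /qform big1 // => a _; rewrite big1 // => b _; rewrite mulr0 mul0r.
Qed.

End PhotonLoss.

Section Reconstruction.
Variable R : realType.
Local Notation C := R[i].

Lemma density_perturb (M N : nat) (H : fock M N -> fock M N -> C) (t : C) :
  (0 < #|{: fock M N}|)%N -> selfadjoint H -> trace H = 0 -> t \is Num.real ->
  `|t| * entry_norm H <= #|{: fock M N}|%:R^-1 ->
  density (fun a b => t * H a b + scalar_op #|{: fock M N}|%:R^-1 a b).
Proof.
move=> fock_gt0 H_adj H_trace0 t_real tH_small.
have tH_adj : selfadjoint (fun a b => t * H a b).
  by move=> a b; rewrite rmorphM /= conj_Creal // -H_adj.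
split; [|split] => [a b | v |].
- by rewrite rmorphD /= -tH_adj /scalar_op rmorphM fmorphV /= !conjC_nat eq_sym.
- by apply: qform_perturb_ge0 => //; rewrite entry_normZ.
- rewrite big_split /= -mulr_sumr -/(trace H) H_trace0 mulr0 add0r.
  by rewrite -/(trace _) trace_scalar_op mulfV // pnatr_eq0 -lt0n.
Qed.

Section Injectivity.
Variables (M M' N Rn : nat) (g : 'I_Rn -> 'M[C]_M').
Hypothesis g_rec : allows_reconstruction M N g.
Implicit Types X H : fock M N -> fock M N -> C.

Lemma reconstruction_selfadjoint_eq0 H :
  selfadjoint H -> trace H = 0 -> (forall j nu, prob H (g j) nu = 0) ->
  H =2 (fun _ _ => 0).
Proof.
move=> H_adj H_trace0 H_prob0 a b.
have fock_gt0 : (0 < #|{: fock M N}|)%N by apply/card_gt0P; exists a.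
pose mixed : fock M N -> fock M N -> C := scalar_op #|{: fock M N}|%:R^-1.
pose rho t (a b : fock M N) := t * H a b + mixed a b.
have rho_prob t j nu : prob (rho t) (g j) nu = prob mixed (g j) nu.
  by rewrite prob_linear H_prob0 mulr0 add0r.
pose eps : C := (#|{: fock M N}|%:R * (1 + entry_norm H))^-1.
have norm_ge0 : 0 <= entry_norm H by rewrite sumr_ge0 // => c _; rewrite sumr_ge0.
have eps_gt0 : 0 < eps by rewrite invr_gt0 mulr_gt0 ?ltr0n // ltr_pwDl.
have rho0_density : density (rho 0).
  by apply: density_perturb; rewrite ?real0 // normr0 mul0r invr_ge0 ler0n.
have rho_eps_density : density (rho eps).
  apply: density_perturb; rewrite ?gtr0_real ?gtr0_norm //.
  rewrite /eps invfM -mulrA ler_piMr ?invr_ge0 ?ler0n //.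
  by rewrite ler_pdivrMl ?ltr_pwDl // mulr1 lerDr.
have rho_eq : rho eps = rho 0 by apply: g_rec => // j nu; rewrite !rho_prob.
have := congr1 (fun r => r a b) rho_eq; rewrite /rho mul0r => /addIr /eqP.
by rewrite mulf_eq0 gt_eqF //= => /eqP.
Qed.

Lemma reconstruction_eq0 X :
  trace X = 0 -> (forall j nu, prob X (g j) nu = 0) -> X =2 (fun _ _ => 0).
Proof.
move=> X_trace0 X_prob0.
have herm_part0 c : herm_part (fun a b => c * X a b) =2 (fun _ _ => 0).
  apply: reconstruction_selfadjoint_eq0; first exact: herm_part_selfadjoint.
    rewrite /trace /herm_part big_split /= -rmorph_sum -mulr_sumr -/(trace X) X_trace0 mulr0.
    by rewrite add0r rmorph0.
  move=> j nu; rewrite prob_qform qform_herm_part qformZ -prob_qform X_prob0.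
  by rewrite mulr0 conjC0 addr0.
move=> a b; apply: herm_part_eq0 (herm_part0 'i a b).
by rewrite -[RHS](herm_part0 1 a b) /herm_part !mul1r.
Qed.

End Injectivity.

Lemma ex_loss_ker_invisible (M M' N Rn : nat) (k : 'I_M') (g : 'I_Rn -> 'M[C]_M') :
  (#|{: fock M N}| ^ 2 + Rn * #|[pred nu : fock M' N.+1 | occ nu k == 0%N]| <
   #|{: fock M N.+1}| ^ 2)%N ->
  exists X : fock M N.+1 -> fock M N.+1 -> C,
    [/\ exists a b, X a b != 0, loss X =2 (fun _ _ => 0) &
        forall j nu, occ nu k = 0%N -> prob X (g j) nu = 0].
Proof.
move=> lt_card.
pose entries := {ffun fock M N.+1 * fock M N.+1 -> C^o}.
pose empty_k := {nu : fock M' N.+1 | occ nu k == 0%N}.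
pose equations (x : entries) :
    {ffun fock M N * fock M N -> C^o} * {ffun 'I_Rn * empty_k -> C^o} :=
  ([ffun p => loss (curry x) p.1 p.2], [ffun o => prob (curry x) (g o.1) (val o.2)]).
have equations_linear : linear equations.
  move=> c x y; have curryE : curry (c *: x + y) =2 (fun a b => c * x (a, b) + y (a, b)).
    by move=> a b; rewrite /curry !ffunE.
  congr pair; apply/ffunP => o; rewrite !ffunE.
    by rewrite -loss_linear; apply: eq_bigr => i _; rewrite curryE.
  by rewrite -prob_linear !prob_qform; apply: eq_qform.
have [|x x_neq0 [/ffunP loss0 /ffunP prob0]] := ex_linear_ker_neq0 equations_linear.
  rewrite dim_prod !dim_ffun_regular !card_prod card_ord !mulnn.
  by rewrite (card_sig (fun nu : fock M' N.+1 => occ nu k == 0%N)).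
exists (curry x); split=> [|a b|j nu /eqP nu_k].
- have [[a b] xab | x0] := pickP (fun p => x p != 0); first by exists a, b.
  by case/eqP: x_neq0; apply/ffunP => p; rewrite ffunE; apply/eqP/negPn; rewrite x0.
- by have := loss0 (a, b); rewrite !ffunE.
- by have := prob0 (j, exist _ nu nu_k); rewrite !ffunE.
Qed.

Lemma reconstruction_count (M M' N Rn : nat) (k : 'I_M') (g : 'I_Rn -> 'M[C]_M') :
  (M <= M')%N -> (forall j, unitary (g j)) -> allows_reconstruction M N.+1 g ->
  (#|{: fock M N.+1}| ^ 2 <=
   #|{: fock M N}| ^ 2 + Rn * #|[pred nu : fock M' N.+1 | occ nu k == 0%N]|)%N.
Proof.
move=> leMM' g_unitary g_rec; rewrite leqNgt; apply/negP.
move=> /(ex_loss_ker_invisible g)[X [[a [b X_neq0]] X_loss0 X_empty0]].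
have X_trace0 : trace X = 0.
  apply: (mulfI (_ : N.+1%:R != 0)); first by rewrite pnatr_eq0.
  by rewrite -trace_loss mulr0 /trace big1.
have X_prob0 j : forall nu, prob X (g j) nu = 0.
  exact: prob_eq0_of_loss_eq0 leMM' (g_unitary j) X_loss0 (X_empty0 j).
by rewrite (reconstruction_eq0 g_rec X_trace0 X_prob0) eqxx in X_neq0.
Qed.

End Reconstruction.

Lemma R_NME (n p : nat) :
  R_NM n.+1 p.+2 = ('C(p.+1 + n.+1, p.+1) + 'C(p.+1 + n, p.+1))%N.
Proof.
rewrite /R_NM -bin_sub ?leq_addr // addKn.
have -> : (n.+1 + p.+2 = (p + n).+3)%N by lia.
rewrite !subSS subn0 !(addnS, addSn) (binS (p + n).+2 p.+1) (binS (p + n).+1 p.+1).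
by rewrite addnAC -addnA addKn addnC.
Qed.

Lemma R_NMM'E (N p m : nat) :
  R_NMM' N p.+2 m.+2 =
  Num.ceil ('C(p + N, p)%:R / 'C(m + N, m)%:R * (R_NM N p.+2)%:R : rat).
Proof.
have fact_binE q : (N + q.+2 - 2)`! = ('C(q + N, q) * (q`! * N`!))%N.
  by rewrite !addnS !subSS subn0 addnC -(bin_fact (leq_addr N q)) addKn.
rewrite /R_NMM' !fact_binE !subSS !subn0 !natrM.
have fact_neq0 q : q`!%:R != 0 :> rat by rewrite pnatr_eq0 -lt0n fact_gt0.
have bin_neq0 : 'C(m + N, m)%:R != 0 :> rat by rewrite pnatr_eq0 -lt0n bin_gt0 leq_addr.
by congr Num.ceil; field; rewrite !fact_neq0 bin_neq0.
Qed.

Lemma reconstruction_bound (R : realType) (n p m Rn : nat) (g : 'I_Rn -> 'M[R[i]]_m.+2) :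
  (p <= m)%N -> (forall j, unitary (g j)) -> allows_reconstruction p.+2 n.+1 g ->
  ('C(p + n.+1, p) * R_NM n.+1 p.+2 <= Rn * 'C(m + n.+1, m))%N.
Proof.
move=> lepm g_unitary g_rec.
have := reconstruction_count ord0 (lepm : p.+2 <= m.+2)%N g_unitary g_rec.
rewrite card_fock_empty_mode -leq_subLR subn_sqr.
rewrite -{1}(card_empty_mode n (ord0 : 'I_p.+2)) addnK card_fock_empty_mode !card_fock.
by rewrite -R_NME.
Qed.

Theorem theorem2 (R : realType) (N M : nat) (hN : (1 <= N)%N) (hM : (2 <= M)%N) :
  (forall (Rn : nat) (g : 'I_Rn -> 'M[R[i]]_M),
     (forall j, unitary (g j)) ->
     @allows_reconstruction R M M N Rn g -> (R_NM N M <= Rn)%N) /\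
  (forall (M' Rn : nat) (g : 'I_Rn -> 'M[R[i]]_M'),
     (M < M')%N ->
     (forall j, unitary (g j)) ->
     @allows_reconstruction R M M' N Rn g -> R_NMM' N M M' <= Rn%:Z).
Proof.
case: N hN => // n _; case: M hM => [|[|p]] // _.
split=> [Rn g g_unitary g_rec | [|[|m]] // Rn g ltpm g_unitary g_rec].
  have := reconstruction_bound (leqnn p) g_unitary g_rec.
  by rewrite mulnC leq_pmul2r // bin_gt0 leq_addr.
have bound := reconstruction_bound (ltnW ltpm : (p <= m)%N) g_unitary g_rec.
rewrite R_NMM'E ceil_le_int mulrAC ler_pdivrMr ?ltr0n ?bin_gt0 ?leq_addr //.
by rewrite pmulrn -!natrM ler_nat.
Qed.
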